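(* Let $0\le t'<t\le 1$, $\Delta t=t-t'$, $\varepsilon_t\ge 0$, and suppose the data distribution is a point mass at $\mathbf{z}_\star\in\mathbb{R}^d$, so that $\mathbf{z}_t=(1-t)\mathbf{z}_\star+t\boldsymbol{\epsilon}$ with $\boldsymbol{\epsilon}\sim\mathcal{N}(\mathbf{0},\mathbf{I})$, with density $p_t$ and velocity $\mathbf{u}_t=\boldsymbol{\epsilon}-\mathbf{z}_\star$. Let $\mathbf{w}\sim\mathcal{N}(\mathbf{0},\mathbf{I})$ be independent of $\boldsymbol{\epsilon}$. Then the Euler–Maruyama step $$\mathbf{z}_{t'}^{\mathrm{Euler}}=\mathbf{z}_t+\Bigl(-\mathbf{u}_t+\tfrac12\varepsilon_t^2\nabla_{\mathbf{z}}\log p_t(\mathbf{z}_t)\Bigr)\Delta t+\varepsilon_t\sqrt{\Delta t}\,\mathbf{w}$$ satisfies $$\mathbf{z}_{t'}^{\mathrm{Euler}}=(1-t')\mathbf{z}_\star+\Bigl(t'-\frac{\varepsilon_t^2\Delta t}{2t}\Bigr)\boldsymbol{\epsilon}+\varepsilon_t\sqrt{\Delta t}\,\mathbf{w},$$ so its total Gaussian noise coefficient (the standard deviation of each coordinate of $\mathbf{z}_{t'}^{\mathrm{Euler}}-(1-t')\mathbf{z}_\star$) is $$\sqrt{\Bigl(t'-\frac{\varepsilon_t^2\Delta t}{2t}\Bigr)^2+\varepsilon_t^2\Delta t},$$ and this is strictly larger than $t'$ whenever $\varepsilon_t>0$.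
   Context: Flow-matching path: $\mathbf{z}_t=(1-t)\mathbf{z}_0+t\boldsymbol{\epsilon}$ with $\boldsymbol{\epsilon}\sim\mathcal{N}(\mathbf{0},\mathbf{I})$ independent of the data sample $\mathbf{z}_0$; here $\mathbf{z}_0=\mathbf{z}_\star$ almost surely. The step discretizes, backward from $t$ to $t'$, the reverse SDE $\mathrm{d}\mathbf{z}_t=(\mathbf{u}_t-\tfrac12\varepsilon_t^2\nabla_{\mathbf{z}}\log p_t(\mathbf{z}_t))\,\mathrm{d}t+\varepsilon_t\,\mathrm{d}\mathbf{w}_t$. The correct noise coefficient at time $t'$ under the flow-matching path is $t'$. *)

(* Defs.v *)
From HB Require Import structures.
From mathcomp Require Import all_boot all_order all_algebra.
From mathcomp Require Import all_classical all_reals all_analysis.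

Set Implicit Arguments.
Unset Strict Implicit.
Unset Printing Implicit Defensive.

Import Order.TTheory GRing.Theory Num.Theory.
Import numFieldNormedType.Exports.

Local Open Scope classical_set_scope.
Local Open Scope ring_scope.

(* Row vectors carry the sigma-algebra generated by the coordinates, as tuples
   do in the library; on 'rV[R]_n this is the Borel sigma-algebra of R^n. *)
Section measurable_rV.
Context {d} {T : measurableType d}.
Variable n : nat.

Let coors : 'I_n -> 'rV[T]_n -> T := fun i v => v 0 i.

Let rV_set0 : g_sigma_preimage coors set0.
Proof. exact: sigma_algebra0. Qed.

Let rV_setC A : g_sigma_preimage coors A -> g_sigma_preimage coors (~` A).
Proof. exact: sigma_algebraC. Qed.

Let rV_bigcup (F : _^nat) : (forall i, g_sigma_preimage coors (F i)) ->
  g_sigma_preimage coors (\bigcup_i (F i)).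
Proof. exact: sigma_algebra_bigcup. Qed.

HB.instance Definition _ := @isMeasurable.Build (measure_tuple_display d)
  'rV[T]_n (g_sigma_preimage coors) rV_set0 rV_setC rV_bigcup.

End measurable_rV.

Section measurable_rV_fun.
Context d1 d2 (T1 : measurableType d1) (T2 : measurableType d2).

Lemma measurable_coord n (i : 'I_n) :
  measurable_fun [set: 'rV[T2]_n] (fun v => v 0 i).
Proof.
move=> _ Y mY; rewrite setTI; apply: sub_sigma_algebra => /=.
rewrite -bigcup_seq/=; exists i => /=; first by rewrite mem_index_enum.
by exists Y => //; rewrite setTI.
Qed.

Lemma measurable_fun_rVP n (f : T1 -> 'rV[T2]_n) :
  measurable_fun [set: T1] f <->
  forall i, measurable_fun [set: T1] (fun x => f x 0 i).
Proof.
split=> [mf i|mf].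
  exact: (measurableT_comp (@measurable_coord n i)).
apply: (@measurability _ _ _ _ setT f
  (\big[setU/set0]_(i < n) preimage_set_system setT
     (fun v : 'rV[T2]_n => v 0 i) measurable)) => //.
move=> _ [A +] <-; rewrite -bigcup_seq => -[i _ [B mB <-]].
by have := mf i measurableT B mB; rewrite !setTI.
Qed.

End measurable_rV_fun.

(* The n-fold product mu \x ... \x mu of a measure on R, on 'rV[R]_n. *)
Section power_measure.
Context {R : realType}.

Definition rV_cons n (u : measurableTypeR R * 'rV[R]_n) : 'rV[R]_n.+1 :=
  \row_i oapp (u.2 0) u.1 (unlift ord0 i).

Definition rV_uncons n (v : 'rV[R]_n.+1) : measurableTypeR R * 'rV[R]_n :=
  (v 0 ord0, \row_i v 0 (lift ord0 i)).

Lemma rV_consE0 n (u : measurableTypeR R * 'rV[R]_n) : rV_cons u 0 ord0 = u.1.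
Proof. by rewrite mxE unlift_none. Qed.

Lemma rV_consES n (u : measurableTypeR R * 'rV[R]_n) i : rV_cons u 0 (lift ord0 i) = u.2 0 i.
Proof. by rewrite mxE liftK. Qed.

Lemma rV_consK n : cancel (@rV_cons n) (@rV_uncons n).
Proof.
move=> [x v]; rewrite /rV_uncons rV_consE0; congr pair.
by apply/rowP => i; rewrite mxE rV_consES.
Qed.

Lemma measurable_rV_cons n : measurable_fun [set: measurableTypeR R * 'rV[R]_n] (@rV_cons n).
Proof.
apply/measurable_fun_rVP => i; case: (unliftP ord0 i) => [j|] ->.
  rewrite (_ : (fun _ => _) = (fun v : 'rV[R]_n => v 0 j) \o snd); last first.
    by apply/funext => u /=; rewrite rV_consES.
  by apply: measurableT_comp => //; exact: measurable_coord.
rewrite (_ : (fun _ => _) = fst)//.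
by apply/funext => u /=; rewrite rV_consE0.
Qed.

Lemma measurable_rV_uncons n :
  measurable_fun [set: 'rV[R]_n.+1] (@rV_uncons n).
Proof.
apply/measurable_fun_pairP; split => /=; first exact: measurable_coord.
apply/measurable_fun_rVP => i.
rewrite (_ : (fun _ => _) = fun v : 'rV[R]_n.+1 => v 0 (lift ord0 i)).
  exact: measurable_coord.
by apply/funext => v /=; rewrite mxE.
Qed.

HB.instance Definition _ n := @isMeasurableFun.Build _ _ _ _
  (@rV_cons n) (@measurable_rV_cons n).

Section cons.
Variables (mu : {sigma_finite_measure set (measurableTypeR R) -> \bar R}) (n : nat).
Variable nu : {sigma_finite_measure set 'rV[R]_n -> \bar R}.

Definition cons_measure : set 'rV[R]_n.+1 -> \bar R :=
  pushforward (mu \x nu)%E (@rV_cons n).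

Let cons_measure0 : cons_measure set0 = 0%E.
Proof. exact: measure0. Qed.

Let cons_measure_ge0 A : (0 <= cons_measure A)%E.
Proof. exact: measure_ge0. Qed.

Let cons_measure_sigma_additive : semi_sigma_additive cons_measure.
Proof.
exact: measure_semi_sigma_additive.
Qed.

HB.instance Definition _ := isMeasure.Build _ _ _ cons_measure
  cons_measure0 cons_measure_ge0 cons_measure_sigma_additive.

Let cons_measure_sigma_finite : sigma_finite setT cons_measure.
Proof.
have [F TF Foo] : sigma_finite setT (mu \x nu)%E.
  have /sigma_finiteP[F [TF ndF Foo]] := sigma_finiteT mu.
  have /sigma_finiteP[G [TG ndG Goo]] := sigma_finiteT nu.
  exists (fun k => F k `*` G k) => [|k].
    rewrite -setXTT TF TG predeqE => -[x y]; split.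
      move=> [/= [k _ Fkx] [l _ Gly]]; exists (maxn k l) => //; split.
      - by move: x Fkx; exact/subsetPset/ndF/leq_maxl.
      - by move: y Gly; exact/subsetPset/ndG/leq_maxr.
    by move=> [k _ []/= ? ?]; split; exists k.
  have [? ?] := Foo k; have [? ?] := Goo k; split; first exact: measurableX.
  by rewrite product_measure1E// lte_mul_pinfty// ge0_fin_numE.
exists (fun k => @rV_uncons n @^-1` F k).
  by rewrite -preimage_bigcup -TF.
move=> k; have [mF F_fin] := Foo k; split.
  by rewrite -[X in measurable X]setTI; exact: measurable_rV_uncons.
rewrite /cons_measure /pushforward -comp_preimage.
by rewrite (_ : _ \o _ = id) // funeqE => u /=; exact: rV_consK.
Qed.

HB.instance Definition _ := Measure_isSigmaFinite.Build _ _ _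
  cons_measure cons_measure_sigma_finite.

End cons.

Fixpoint power_measure (mu : {sigma_finite_measure set (measurableTypeR R) -> \bar R}) (n : nat) :
    {sigma_finite_measure set 'rV[R]_n -> \bar R} :=
  match n with
  | 0 => \d_(0 : 'rV[R]_0)
  | n'.+1 => cons_measure mu (power_measure mu n')
  end.

End power_measure.

Definition lebesgue_rV (R : realType) (n : nat) :
    {sigma_finite_measure set 'rV[R]_n -> \bar R} :=
  power_measure lebesgue_measure n.

Definition std_normal_rV (R : realType) (n : nat) :
    {sigma_finite_measure set 'rV[R]_n -> \bar R} :=
  power_measure (normal_prob 0 1) n.

Section random_vectors.
Context d (T : measurableType d) (R : realType) (P : probability T R).
Variable n : nat.

Definition has_law (X : {RV P >-> 'rV[R]_n}) (mu : set 'rV[R]_n -> \bar R) :=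
  forall A, measurable A -> distribution P X A = mu A.

Definition independent_RV (X Y : {RV P >-> 'rV[R]_n}) :=
  forall A B, measurable A -> measurable B ->
    P (X @^-1` A `&` Y @^-1` B) = (P (X @^-1` A) * P (Y @^-1` B))%E.

(* A density is determined only up to a null set, but at most one density is
   continuous; fixing it makes pointwise values and the score meaningful. *)
Definition is_continuous_density (X : T -> 'rV[R]_n) (p : 'rV[R]_n -> R) :=
  [/\ continuous p, forall z, 0 <= p z, measurable_fun setT p &
    forall A, measurable A ->
      P (X @^-1` A) = (\int[lebesgue_rV R n]_(z in A) (p z)%:E)%E].

Definition std_dev (X : T -> R) : \bar R := sqrte ('V_P[X])%E.

End random_vectors.

Section flow_matching.
Context (R : realType) (n : nat).
Implicit Types z : 'rV[R]_n.

Definition gradient (f : 'rV[R]_n -> R) z : 'rV[R]_n :=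
  \row_i 'D_(delta_mx 0 i) f z.

Definition score (p : 'rV[R]_n -> R) : 'rV[R]_n -> 'rV[R]_n :=
  gradient (fun z => ln (p z)).

Definition flow_path (t : R) z0 e : 'rV[R]_n := (1 - t) *: z0 + t *: e.

(* One Euler-Maruyama step, run backward in time over a step of length dt, of
   dz = (u - 1/2 s^2 score) dt + s dw. *)
Definition euler_maruyama (p : 'rV[R]_n -> R) (s dt : R) z u w : 'rV[R]_n :=
  z + dt *: (- u + (2^-1 * s ^+ 2) *: score p z) + (s * Num.sqrt dt) *: w.

End flow_matching.

(* Main.v *)
Require Import Defs.
From HB Require Import structures.
From mathcomp Require Import all_boot all_order all_algebra.
From mathcomp Require Import all_classical all_reals all_analysis.
From mathcomp Require Import measurable_realfun.
From mathcomp Require Import ring lra.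
Import Order.TTheory GRing.Theory Num.Theory.
Import numFieldNormedType.Exports.
Local Open Scope classical_set_scope.
Local Open Scope ring_scope.
Set Implicit Arguments.
Unset Strict Implicit.
Unset Printing Implicit Defensive.

(** The law of [z_t] is Gaussian with mean [m = (1 - t) z*] and standard
    deviation [t], and two continuous densities of the same law coincide
    everywhere, because boxes have positive Lebesgue measure.  Hence [p] is the
    Gaussian density and its score at [z_t] is [- (z_t - m) / t^2], which equals
    [- eps / t] almost surely.  The Euler step is therefore affine in the two
    independent standard normal vectors [eps] and [w], and variances add.  With
    [k = s^2 dt] the squared noise coefficient is
    [t'^2 + (k / (2 t))^2 + k dt / t], which exceeds [t'^2]. *)

(** * Affine changes of variable for Lebesgue measure on the line *)

Section affine.
Context {R : realType}.
Notation mu := (@lebesgue_measure R).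

Definition affine_fun (m t x : R) : R := m + t * x.

Lemma measurable_affine_fun m t :
  measurable_fun [set: measurableTypeR R] (affine_fun m t : _ -> measurableTypeR R).
Proof. by apply: measurable_funD => //; exact: measurable_funM. Qed.

(** Lebesgue measure is determined by its values on half-open intervals, and [t] times the
    pushforward has the same values there: the preimage of []a, b]] is an interval of length
    [(b - a) / t]. *)
Lemma lebesgue_measure_affine (m t : R) (t0 : 0 < t) (A : set (measurableTypeR R)) :
  measurable A ->
  mu (affine_fun m t @^-1` A) = ((t^-1)%:E * mu A)%E.
Proof.
move=> mA.
have tge0 : 0 <= t by exact: ltW.
pose nu : {measure set (measurableTypeR R) -> \bar R} :=
  mscale (NngNum tge0) (pushforward mu (affine_fun m t : measurableTypeR R -> measurableTypeR R)).
suff -> : mu A = nu (measurable_affine_fun m t) A.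
  by rewrite /nu /= /mscale /= muleA -EFinM mulVf ?gt_eqF// mul1e.
apply: lebesgue_measure_unique => // _ [[a b] _ <-].
rewrite /nu /= /mscale /= /pushforward.
have -> : affine_fun m t @^-1` `]a, b] = [set` `](a - m) / t, (b - m) / t]].
  apply/seteqP; split => x /=; rewrite !in_itv/= /affine_fun.
    move=> /andP[h1 h2]; rewrite ltr_pdivrMr// ler_pdivlMr//.
    by apply/andP; split; lra.
  move=> /andP[]; rewrite ltr_pdivrMr// ler_pdivlMr// => h1 h2.
  by apply/andP; split; lra.
rewrite !lebesgue_measure_itv/= !lte_fin ltr_pM2r ?invr_gt0// ltrD2r.
case: ifPn => _; last by rewrite mule0.
by rewrite -!EFinD -EFinM; congr EFin; field; rewrite gt_eqF.
Qed.

Lemma ge0_integral_lebesgue_affine (m t : R) (f : R -> \bar R) : 0 < t ->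
  measurable_fun [set: R] f -> (forall x, (0 <= f x)%E) ->
  (\int[mu]_x f (m + t * x)%R = \int[mu]_x (f x * (t^-1)%:E))%E.
Proof.
move=> t0 mf f0.
have it0 : 0 <= t^-1 by rewrite invr_ge0 ltW.
have := ge0_integral_pushforward (measurable_affine_fun m t) mu measurableT mf
  (fun x _ => f0 x).
rewrite preimage_setT => <-.
rewrite (eq_measure_integral (mscale (NngNum it0) mu)); last first.
- by move=> ? A mA _; rewrite /= /pushforward lebesgue_measure_affine.
- exact: measurable_affine_fun.
by rewrite ge0_integral_mscale//= muleC ge0_integralZr.
Qed.

End affine.

(** * Integration against normal laws on the line *)

Section normal.
Context {R : realType}.
Notation mu := (@lebesgue_measure R).
Notation N01 := (@normal_prob R 0 1).

(** The Radon-Nikodym derivative of the normal law and [normal_pdf] have the same integral over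
    every measurable set, so they agree almost everywhere and either may serve as the weight. *)
Lemma ge0_integral_normal_prob m s (f : R -> \bar R) :
  measurable_fun [set: R] f -> (forall x, (0 <= f x)%E) ->
  (\int[normal_prob m s]_x f x = \int[mu]_x (f x * (normal_pdf m s x)%:E))%E.
Proof.
move=> mf f0.
have dom := normal_prob_dominates m s.
rewrite -(Radon_Nikodym_SigmaFinite.change_of_variables dom f0 measurableT)//.
have mpdf : measurable_fun [set: R] (fun x => (normal_pdf m s x)%:E).
  by apply/measurable_EFinP; exact: measurable_normal_pdf.
have iRN := Radon_Nikodym_SigmaFinite.f_integrable dom.
apply: ae_eq_integral => //.
- by apply: emeasurable_funM => //; exact: (measurable_int mu iRN).
- exact: emeasurable_funM.
apply: ae_eqe_mul2l; apply: integral_ae_eq => // E _ mE.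
by rewrite -(Radon_Nikodym_SigmaFinite.f_integral dom).
Qed.

Lemma normal_pdf_affine (m t x : R) : 0 < t ->
  normal_pdf 0 1 ((x - m) / t) * t^-1 = normal_pdf m t x.
Proof.
move=> t0; rewrite !normal_pdfE ?gt_eqF//= /normal_peak /normal_fun.
rewrite subr0 mulrAC; congr (_ * expR _).
  rewrite expr1n mul1r -(mulrnAr (t ^+ 2)) sqrtrM ?sqr_ge0// sqrtr_sqr gtr0_norm//.
  by rewrite invfM mulrC.
by field; rewrite gt_eqF.
Qed.

Lemma ge0_integral_normal_affine (m t : R) (f : R -> \bar R) : 0 < t ->
  measurable_fun [set: R] f -> (forall x, (0 <= f x)%E) ->
  (\int[N01]_x f (m + t * x)%R = \int[mu]_x (f x * (normal_pdf m t x)%:E))%E.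
Proof.
move=> t0 mf f0; have mfa := measurableT_comp mf (measurable_affine_fun m t).
rewrite (ge0_integral_normal_prob 0 1 mfa (fun x => f0 _)).
(* [h] is the integrand expressed in the variable [m + t * x], which prepares the affine
   substitution. *)
pose h x := (f x * (normal_pdf 0 1 ((x - m) / t))%:E)%E.
transitivity (\int[mu]_x h (m + t * x)%R)%E.
  apply: eq_integral => x _; rewrite /h.
  by rewrite [_ - m](_ : _ = t * x) 1?mulrAC ?mulfV ?mul1r ?gt_eqF//; ring.
rewrite ge0_integral_lebesgue_affine//.
- apply: eq_integral => x _; rewrite /h -muleA -EFinM.
  by rewrite normal_pdf_affine.
- apply: emeasurable_funM => //; apply/measurable_EFinP.
  apply: measurableT_comp; first exact: measurable_normal_pdf.
  by apply: measurable_funM => //; exact: measurable_funB.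
- by move=> x; rewrite mule_ge0// lee_fin normal_pdf_ge0.
Qed.

End normal.

(** * Power measures on row vectors: Tonelli, boxes and marginals *)

Lemma integral_cst_total_mass1 d (T : measurableType d) (R : realType)
    (mu : {measure set T -> \bar R}) (c : \bar R) :
  mu setT = 1%E -> (\int[mu]_x c = c)%E.
Proof. by move=> mu1; rewrite (integral_cst mu measurableT) mu1 mule1. Qed.

Section power_measure_theory.
Context {R : realType}.

Section cons.
Variables (mu : {sigma_finite_measure set (measurableTypeR R) -> \bar R}) (n : nat).
Variable nu : {sigma_finite_measure set 'rV[R]_n -> \bar R}.

Lemma ge0_integral_cons_measure (f : 'rV[R]_n.+1 -> \bar R) :
  measurable_fun setT f -> (forall z, (0 <= f z)%E) ->
  (\int[cons_measure mu nu]_z f z =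
   \int[mu]_x \int[nu]_v f (rV_cons (x, v)))%E.
Proof.
move=> mf f0.
transitivity (\int[mu \x nu]_u f (rV_cons u))%E.
  have := ge0_integral_pushforward (@measurable_rV_cons R n) (mu \x nu)%E
    measurableT mf (fun x _ => f0 x).
  by rewrite preimage_setT => <-; exact: eq_measure_integral.
rewrite fubini_tonelli1//.
exact: (measurableT_comp mf (@measurable_rV_cons R n)).
Qed.

End cons.

Lemma measurable_box n (A : 'I_n -> set (measurableTypeR R)) :
  (forall i, measurable (A i)) -> measurable [set v : 'rV[R]_n | forall i, A i (v 0 i)].
Proof.
move=> mA.
rewrite (_ : [set v | _] = \bigcap_(i in [set: 'I_n]) ((fun v : 'rV[R]_n => v 0 i) @^-1` A i)).
  apply: fin_bigcap_measurable; [exact: finite_finset|]=> i _; rewrite -[X in measurable X]setTI.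
  exact: (@measurable_coord _ _ _ i measurableT _ (mA i)).
by apply/seteqP; split => [v h i _|v h i]; [exact: h|exact: (h i I)].
Qed.

(** Induction on [n]: the preimage of a box under [rV_cons] is a rectangle, with the first side as
    one factor and the box of the remaining sides as the other. *)
Lemma power_measure_box (mu : {sigma_finite_measure set (measurableTypeR R) -> \bar R}) n
    (A : 'I_n -> set (measurableTypeR R)) : (forall i, measurable (A i)) ->
  (power_measure mu n [set v : 'rV[R]_n | forall i, A i (v 0%R i)] = \prod_(i < n) mu (A i))%E.
Proof.
elim: n A => [|n IH] A mA.
  by rewrite big_ord0 /= diracE mem_set// => -[].
rewrite big_ord_recl -IH// /= /cons_measure /pushforward.
rewrite -product_measure1E//; last by apply: (measurable_box (A := fun i => A (lift ord0 i))) => i; exact: mA.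
congr product_measure1; apply/seteqP; split => [[x v]|[x v] [/= h0 h]] /=.
  move=> h; split => [|i]; first by have := h ord0; rewrite rV_consE0.
  by have := h (lift ord0 i); rewrite rV_consES.
by move=> i; case: (unliftP ord0 i) => [j|] ->; rewrite ?rV_consES ?rV_consE0.
Qed.

Lemma power_measure_setT (mu : {sigma_finite_measure set (measurableTypeR R) -> \bar R}) n :
  mu setT = 1%E -> power_measure mu n setT = 1%E.
Proof.
move=> mu1; have := @power_measure_box mu n (fun=> setT) (fun=> measurableT).
by rewrite big1// => <-; congr (_ _); apply/seteqP; split.
Qed.

(** The marginals of a power of a probability measure: all coordinates other than [i] integrate out
    to their total mass, which is 1. *)
Lemma ge0_integral_power_measure_coord
    (mu : {sigma_finite_measure set (measurableTypeR R) -> \bar R}) n (i : 'I_n)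
    (f : R -> \bar R) : mu setT = 1%E ->
  measurable_fun [set: R] f -> (forall x, (0 <= f x)%E) ->
  (\int[power_measure mu n]_v f (v 0%R i) = \int[mu]_x f x)%E.
Proof.
move=> mu1 mf f0; elim: n i => [[]//|n IH] i.
rewrite ge0_integral_cons_measure//; last first.
  exact: (measurableT_comp mf (@measurable_coord _ _ _ _)).
case: (unliftP ord0 i) => [j|] ->.
  under eq_integral do under eq_integral do rewrite rV_consES.
  by under eq_integral do rewrite IH; exact: integral_cst_total_mass1.
apply: eq_integral => x _; under eq_integral do rewrite rV_consE0.
exact: (integral_cst_total_mass1 (f x) (power_measure_setT n mu1)).
Qed.

End power_measure_theory.

(** * The isotropic Gaussian density in dimension [n] *)

Section gaussian.
Context {R : realType}.

(** For [t] positive, the density of the normal law with mean [m] and covariance [t ^+ 2] times the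
    identity; [t] is a standard deviation, not a variance. *)
Definition gaussian_pdf n (m : 'rV[R]_n) (t : R) (z : 'rV[R]_n) : R :=
  \prod_(i < n) normal_pdf (m 0 i) t (z 0 i).

Lemma measurable_gaussian_pdf n (m : 'rV[R]_n) t : measurable_fun setT (gaussian_pdf m t).
Proof.
apply: measurable_prod => i _.
by apply: measurableT_comp; [exact: measurable_normal_pdf|exact: measurable_coord].
Qed.

Lemma gaussian_pdf_ge0 n (m : 'rV[R]_n) t z : 0 <= gaussian_pdf m t z.
Proof. by apply: prodr_ge0 => i _; exact: normal_pdf_ge0. Qed.

Lemma continuous_gaussian_pdf n (m : 'rV[R]_n) t : t != 0 -> continuous (gaussian_pdf m t).
Proof.
move=> t0 z; apply: (cvg_big (U := R) _ (F := nbhs z)) => [|i _].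
  by apply: mul_continuous.
apply: (@continuous_comp _ _ _ (fun z : 'rV[R]_n => z 0 i)).
  exact: coord_continuous.
exact: continuous_normal_pdf.
Qed.

Lemma measurable_rV_affine n (m : 'rV[R]_n) (t : R) :
  measurable_fun [set: 'rV[R]_n] (fun v : 'rV[R]_n => m + t *: v).
Proof.
apply/measurable_fun_rVP => i.
under eq_fun do rewrite !mxE.
by apply: measurable_funD => //; apply: measurable_funM => //; exact: measurable_coord.
Qed.

(** This identifies [gaussian_pdf m t] as the density of [m + t *: v] for a standard normal [v]. The
    induction on [n] splits off the first coordinate: the induction hypothesis treats the tail, the
    one-dimensional substitution treats the head. *)
Lemma ge0_integral_std_normal_affine n (m : 'rV[R]_n) (t : R) (f : 'rV[R]_n -> \bar R) :
  0 < t -> measurable_fun setT f -> (forall z, (0 <= f z)%E) ->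
  (\int[std_normal_rV R n]_v f (m + t *: v)%R =
   \int[lebesgue_rV R n]_z (f z * (gaussian_pdf m t z)%:E))%E.
Proof.
move=> t0; elim: n m f => [|n IH] m f mf f0.
  (* In dimension 0 both measures are the Dirac mass at the only vector, and the density is an empty
     product. *)
  rewrite !integral_dirac//=.
  - rewrite /gaussian_pdf big_ord0 mule1 !diracT !mul1e; congr f.
    by apply/rowP => -[].
  - by apply: emeasurable_funM => //; apply/measurable_EFinP; exact: measurable_gaussian_pdf.
  - exact: (measurableT_comp mf (measurable_rV_affine m t)).
pose m' := \row_i m 0 (lift ord0 i).
have mg : measurable_fun setT (fun z => f z * (gaussian_pdf m t z)%:E)%E.
  by apply: emeasurable_funM => //; apply/measurable_EFinP; exact: measurable_gaussian_pdf.
rewrite !ge0_integral_cons_measure//; first last.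
- exact: (measurableT_comp mf (measurable_rV_affine m t)).
- by move=> z; rewrite mule_ge0// lee_fin gaussian_pdf_ge0.
have E x v : m + t *: rV_cons (x, v) = rV_cons (m 0 ord0 + t * x, m' + t *: v).
  apply/rowP => i; rewrite mxE [LHS]addrC mxE addrC; case: (unliftP ord0 i) => [j|] ->.
    by rewrite !rV_consES/= !mxE.
  by rewrite !rV_consE0.
under eq_integral do under eq_integral do rewrite E.
(* [H y] is the transformed tail integral once the first coordinate of [m + t *: v] is fixed to
   [y]. *)
pose H y := (\int[lebesgue_rV R n]_z (f (rV_cons (y, z)) * (gaussian_pdf m' t z)%:E))%E.
have mfc : measurable_fun setT (f \o @rV_cons R n).
  exact: (measurableT_comp mf (@measurable_rV_cons R n)).
transitivity (\int[normal_prob 0 1]_x H (m 0 ord0 + t * x)%R)%E.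
  apply: eq_integral => x _; apply: (IH m' (fun z => f (rV_cons (_, z)))) => //.
  exact: (measurableT_comp mfc (measurable_pair1 _)).
rewrite ge0_integral_normal_affine//.
- apply: eq_integral => y _; rewrite /H -ge0_integralZr//.
  + apply: eq_integral => v _; rewrite -muleA -EFinM; congr (_ * _%:E)%E.
    rewrite /gaussian_pdf big_ord_recl rV_consE0 mulrC; congr (_ * _).
    by apply: eq_bigr => i _; rewrite rV_consES mxE.
  + apply: emeasurable_funM; first exact: (measurableT_comp mfc (measurable_pair1 _)).
    by apply/measurable_EFinP; exact: measurable_gaussian_pdf.
  + by move=> v _; rewrite mule_ge0// lee_fin gaussian_pdf_ge0.
  + by rewrite lee_fin normal_pdf_ge0.
- apply: (measurable_fun_fubini_tonelli_F
    (fun u : measurableTypeR R * 'rV[R]_n => f (rV_cons u) * (gaussian_pdf m' t u.2)%:E)%E).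
    apply: emeasurable_funM => //; apply/measurable_EFinP.
    by apply: measurableT_comp => //; exact: measurable_gaussian_pdf.
  by move=> u; rewrite mule_ge0// lee_fin gaussian_pdf_ge0.
- by move=> y; apply: integral_ge0 => v _; rewrite mule_ge0// lee_fin gaussian_pdf_ge0.
Qed.

End gaussian.

(** * Uniqueness of continuous densities *)

Section continuous_density.
Context {R : realType}.
Variable n : nat.
Implicit Types (p q : 'rV[R]_n -> R).

(** If [q z < p z], continuity gives constants [d < c] with [q < d] and [c < p] on a box around [z].
    Its measure is positive and finite, so the integrals of [p] and [q] over it cannot be equal. *)
Lemma continuous_density_le p q :
  continuous p -> continuous q ->
  measurable_fun setT p -> measurable_fun setT q ->
  (forall z, 0 <= p z) -> (forall z, 0 <= q z) ->
  (forall A, measurable A ->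
    \int[lebesgue_rV R n]_(z in A) (p z)%:E = \int[lebesgue_rV R n]_(z in A) (q z)%:E)%E ->
  forall z, p z <= q z.
Proof.
move=> cp cq mp mq p0 q0 pq z; rewrite leNgt; apply/negP => qpz.
(* The two points that cut the interval from [q z] to [p z] into thirds. *)
pose c := (p z + q z + p z) / 3; pose d := (p z + q z + q z) / 3.
have cpz : c < p z by rewrite /c; lra.
have dqz : q z < d by rewrite /d; lra.
have dc : d < c by rewrite /c /d; lra.
have d0 : 0 <= d by rewrite (le_trans (q0 z)) ?ltW.
have c0 : 0 <= c by rewrite (le_trans d0) ?ltW.
have near_c : \forall y \near z, c < p y by exact: (cvgr_gt (p z) (cp z) c cpz).
have near_d : \forall y \near z, q y < d by exact: (cvgr_lt (q z) (cq z) d dqz).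
have [e e0 eB] := (nbhs_ballP _ _).1 (filterI near_c near_d).
(* Balls of matrices are defined entrywise, so the ball of radius [e] contains this open box, whose
   measure is [(2 * e) ^+ n]. *)
pose I i := `](z 0 i - e), (z 0 i + e)[%classic : set (measurableTypeR R).
pose B := [set v : 'rV[R]_n | forall i, I i (v 0 i)].
have mI i : measurable (I i) by exact: (measurable_itv `](z 0 i - e), (z 0 i + e)[).
have mB : measurable B by apply: (measurable_box (A := I)); exact: mI.
have BE y : B y -> c < p y /\ q y < d.
  move=> By; apply: eB; split=> // i j; rewrite !ord1.
  have := By j; rewrite /I /= in_itv/= /ball/= ltr_distlC.
  by move=> /andP[h1 h2]; apply/andP; split; lra.
have muB : lebesgue_rV R n B = ((e *+ 2) ^+ n)%:E.
  rewrite power_measure_box//.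
  rewrite (eq_bigr (fun=> (e *+ 2)%:E)) => [|i _].
    by rewrite prodEFin prodr_const card_ord.
  rewrite /= lebesgue_measure_itv/= lte_fin ifT; last by move: e0 => /= e0; lra.
  by rewrite -EFinB; congr EFin; ring.
have en0 : 0 < (e *+ 2) ^+ n by rewrite exprn_gt0// mulrn_wgt0.
have le1 : (c%:E * lebesgue_rV R n B <= \int[lebesgue_rV R n]_(z in B) (p z)%:E)%E.
  rewrite -integral_cst//; apply: ge0_le_integral => //.
  - by apply/measurable_EFinP; exact: measurable_funTS.
  - by move=> y /BE[h _]; rewrite lee_fin ltW.
have le2 : (\int[lebesgue_rV R n]_(z in B) (q z)%:E <= d%:E * lebesgue_rV R n B)%E.
  rewrite -integral_cst//; apply: ge0_le_integral => //.
  - by move=> y _; rewrite lee_fin.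
  - by apply/measurable_EFinP; exact: measurable_funTS.
  - by move=> y /BE[_ h]; rewrite lee_fin ltW.
have := le_trans le1; rewrite pq// => /(_ _ le2).
by rewrite muB -!EFinM lee_fin ler_pM2r// leNgt dc.
Qed.

Lemma continuous_density_unique p q :
  continuous p -> continuous q ->
  measurable_fun setT p -> measurable_fun setT q ->
  (forall z, 0 <= p z) -> (forall z, 0 <= q z) ->
  (forall A, measurable A ->
    \int[lebesgue_rV R n]_(z in A) (p z)%:E = \int[lebesgue_rV R n]_(z in A) (q z)%:E)%E ->
  p = q.
Proof.
move=> cp cq mp mq p0 q0 pq; apply/funext => z; apply/le_anti/andP; split.
  exact: continuous_density_le.
by apply: continuous_density_le => // A mA; rewrite pq.
Qed.

End continuous_density.

(** * The score of a Gaussian density *)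

Section score_gaussian.
Context {R : realType}.
Variables (n : nat) (m : 'rV[R]_n) (t : R).
Hypothesis t0 : 0 < t.

Lemma ln_gaussian_pdf z : ln (gaussian_pdf m t z) =
  \sum_(i < n) (ln (normal_peak t) - (z 0 i - m 0 i) ^+ 2 / (t ^+ 2 *+ 2)).
Proof.
have tn0 : t != 0 by rewrite gt_eqF.
rewrite /gaussian_pdf.
(* Positivity of the partial products is carried through the same induction, because the logarithm
   of a product splits only for positive factors. *)
suff [] : 0 < \prod_(i < n) normal_pdf (m 0 i) t (z 0 i) /\
  ln (\prod_(i < n) normal_pdf (m 0 i) t (z 0 i)) =
  \sum_(i < n) (ln (normal_peak t) - (z 0 i - m 0 i) ^+ 2 / (t ^+ 2 *+ 2)) by [].
elim/big_rec2 : _ => [|i x y _ [y0 lny]]; first by rewrite ln1.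
have pdf0 : 0 < normal_pdf (m 0 i) t (z 0 i).
  by rewrite normal_pdfE// mulr_gt0 ?normal_peak_gt0// expR_gt0.
split; first by rewrite mulr_gt0.
rewrite lnM// lny; congr (_ + _); rewrite normal_pdfE//.
by rewrite lnM ?posrE ?normal_peak_gt0 ?expR_gt0// /normal_fun expRK mulNr.
Qed.

Lemma score_gaussian_pdf z :
  score (gaussian_pdf m t) z = - (t ^+ 2)^-1 *: (z - m).
Proof.
apply/rowP => i; rewrite !mxE.
(* [q] is the part of the log-density that varies along direction [i], up to a constant. The other
   coordinates cancel in the difference quotient, so the directional derivative is the derivative of
   this quadratic at 0. *)
pose q : R -> R :=
  - (t ^+ 2 *+ 2)^-1 *: ((id : R -> R) + cst (z 0 i - m 0 i)) ^+ 2.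
transitivity ('D_1 q 0).
  rewrite /derive; set F := fun h => _; set G := fun h => _.
  suff -> : F = G by [].
  apply/funext => h; rewrite /F /G /=; congr (_ *: _).
  rewrite !ln_gaussian_pdf -sumrB (bigD1 i)//= big1 ?addr0; last first.
    move=> j ji; rewrite !mxE eqxx/= (negbTE ji) mulr0 add0r; ring.
  rewrite !mxE !eqxx /q /= /GRing.scale/= ?mulr1 ?addr0 ?add0r.
  rewrite !fctE /= /GRing.scale/=; field.
  by rewrite gt_eqF.
have h : is_derive (0 : R) (1 : R) q _ := is_deriveZ _
  (is_deriveX _ (is_deriveD (is_derive_id _ _) (is_derive_cst _ _ _))).
rewrite derive_val !fctE /= /GRing.scale/= expr1; field.
by rewrite gt_eqF.
Qed.
End score_gaussian.

(** * The second moment of [gauss_fun] on the half-line *)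

Import gauss_integral_proof.
Section gauss_second_moment.
Context {R : realType}.
Notation mu := (@lebesgue_measure R).

(** The squares of these nonnegative integrals tend to [pi / 4]; take square roots. *)
Lemma cvg_integral0_gauss :
  @integral0_gauss R x @[x --> +oo] --> Num.sqrt pi / 2.
Proof.
have : Num.sqrt (@integral0_gauss R x ^+ 2) @[x --> +oo] --> Num.sqrt (pi / 4).
  apply: continuous_cvg => //;
    [exact: sqrt_continuous|exact: cvg_integral0_gauss_sqr].
rewrite sqrtrM ?pi_ge0// sqrtrV// (_ : 4 = 2 ^+ 2); last by rewrite -natrX.
rewrite sqrtr_sqr ger0_norm//.
rewrite (_ : (fun _ => Num.sqrt _) = integral0_gauss)//.
apply/funext => r; rewrite sqrtr_sqr// ger0_norm//.
exact: integral0_gauss_ge0.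
Qed.

Lemma derive_integral0_gauss (x : R) : 0 < x ->
  derivable (@integral0_gauss R) x 1 /\ ((@integral0_gauss R)^`())%classic x = gauss_fun x.
Proof.
move=> x0; apply: (@continuous_FTC1 R gauss_fun (BLeft 0) _ (x + 1)).
- by rewrite ltrDl.
- apply: continuous_compact_integrable => //; first exact: segment_compact.
  by apply: continuous_subspaceT; exact: continuous_gauss_fun.
- by rewrite /=; rewrite lte_fin.
- by move=> ?; exact: continuous_gauss_fun.
Qed.

(** The bound [1 + x ^+ 2 <= expR (x ^+ 2)] squeezes the function between 0 and [x^-1]. *)
Lemma cvg_mulr_gauss_fun : (x * gauss_fun x) @[x --> +oo] --> (0 : R).
Proof.
apply: (@squeeze_cvgr _ _ _ _ (cst 0) (fun x : R => x^-1)).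
- near=> x; have x0 : 0 < x by [].
  rewrite mulr_ge0 ?gauss_fun_ge0 ?(ltW x0)//= -ler_pdivlMl// /gauss_fun expRN.
  rewrite -invfM lef_pV2 ?posrE ?expR_gt0 ?mulr_gt0// -expr2.
  by rewrite (le_trans _ (expR_ge1Dx _))// lerDr.
- exact: cvg_cst.
- apply/gtr0_cvgV0; last exact: cvg_id.
  by near=> x.
Unshelve. all: end_near. Qed.

Lemma integral0y_sqr_gauss :
  (\int[mu]_(x in `[0%R, +oo[) (x ^+ 2 * gauss_fun x)%:E)%E = (Num.sqrt pi / 4)%:E.
Proof.
(* integration by parts, with [x * gauss_fun x] as boundary term *)
pose F : R -> R := 2^-1 *: (@integral0_gauss R - (id : R -> R) * gauss_fun).
have F0 : F 0 = 0.
  by rewrite /F !fctE mul0r subr0 /integral0_gauss set_itv1 Rintegral_set1 scaler0.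
have dF (x : R) : 0 < x -> is_derive x 1 F (x ^+ 2 * gauss_fun x).
  move=> x0; have [d1 d2] := derive_integral0_gauss x0.
  have h1 : is_derive x (1 : R) (@integral0_gauss R) (gauss_fun x).
    by apply: (DeriveDef d1); rewrite -derive1E.
  have h2 : is_derive x (1 : R) (@gauss_fun R) (- (2 * x) * gauss_fun x).
    have g : is_derive x (1 : R) (- ((id : R -> R) ^+ 2)) _ :=
      is_deriveN (is_deriveX 2 (is_derive_id x 1)).
    apply: (is_derive_eq (is_derive1_comp (is_derive_expR _) g)).
    by rewrite !fctE /gauss_fun /GRing.scale/=; ring.
  have h := is_deriveZ (2^-1) (is_deriveB h1 (is_deriveM (is_derive_id x 1) h2)).
  by apply: (is_derive_eq h); rewrite /GRing.scale/=; field; rewrite ?pnatr_eq0.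
transitivity ((Num.sqrt pi / 4)%:E - (F 0)%:E)%E; last by rewrite F0 sube0.
apply: (@ge0_continuous_FTC2y R (fun x => x ^+ 2 * gauss_fun x)).
- by move=> x x0; rewrite mulr_ge0 ?sqr_ge0// gauss_fun_ge0.
- apply: continuous_subspaceT => x; apply: cvgM; first exact: sqr_continuous.
  exact: continuous_gauss_fun.
- rewrite (_ : _ / 4 = 2^-1 * (Num.sqrt pi / 2 - 0)); last by field.
  apply: (cvgM (f := fun=> 2^-1)); first exact: cvg_cst.
  apply: cvgB; first exact: cvg_integral0_gauss.
  exact: cvg_mulr_gauss_fun.
- by move=> x x0; have [] := dF x x0.
(* Right continuity of [F] at 0: for its integral term, it is read off from continuity on a segment
   starting at 0. *)
- have /continuous_within_itvP[//|_ h _] : {within `[0, 1], continuous (@integral0_gauss R)}.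
    apply: parameterized_integral_continuous => //.
    apply: continuous_compact_integrable => //; first exact: segment_compact.
    by apply: continuous_subspaceT; exact: continuous_gauss_fun.
  apply: (cvgM (f := fun=> 2^-1)); first exact: cvg_cst.
  apply: cvgB; first exact: h.
  apply: cvg_at_right_filter; apply: cvgM; first exact: cvg_id.
  exact: continuous_gauss_fun.
- move=> x; rewrite in_itv/= andbT => x0; rewrite derive1E.
  by have h := dF x x0; rewrite derive_val.
Qed.
End gauss_second_moment.

(** * Second moment and symmetry of the standard normal law *)

Section normal_moments.
Context {R : realType}.
Notation mu := (@lebesgue_measure R).
Notation N01 := (@normal_prob R 0 1).

Lemma integralT_sqr_gauss :
  (\int[mu]_x (x ^+ 2 * gauss_fun x)%:E)%E = (Num.sqrt pi / 2)%:E.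
Proof.
rewrite ge0_symfun_integralT//=.
- rewrite (_ : [set x | _] = `[0, +oo[%classic); last first.
    by apply/seteqP; split => x/=; rewrite in_itv/= andbT.
  by rewrite integral0y_sqr_gauss -EFinM; congr EFin; field.
- by move=> x; rewrite mulr_ge0 ?sqr_ge0 ?gauss_fun_ge0.
- move=> x; apply: cvgM; first exact: sqr_continuous.
  exact: continuous_gauss_fun.
- by move=> x/=; rewrite /gauss_fun sqrrN.
Qed.

Lemma normal_prob01_sqr : (\int[N01]_x (x ^+ 2)%:E = 1)%E.
Proof.
rewrite ge0_integral_normal_prob//; first last.
- by move=> x; rewrite lee_fin sqr_ge0.
- by apply/measurable_EFinP; exact: measurable_funX.
have s0 : 0 < Num.sqrt 2 :> R by rewrite sqrtr_gt0.
have s20 : 0 < (Num.sqrt 2)^-1 :> R by rewrite invr_gt0.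
have p0 : 0 < Num.sqrt pi :> R by rewrite sqrtr_gt0 pi_gt0.
pose h (y : R) := (y ^+ 2 * gauss_fun y)%:E.
have mh : measurable_fun [set: R] h.
  apply/measurable_EFinP; apply: measurable_funM; first exact: measurable_funX.
  exact: measurable_gauss_fun.
have h0 y : (0 <= h y)%E by rewrite lee_fin mulr_ge0 ?sqr_ge0 ?gauss_fun_ge0.
(* Substitute [y = x / Num.sqrt 2], which turns the normal exponent into that of [gauss_fun]; the
   factor 2 comes from [x ^+ 2 = 2 * y ^+ 2]. *)
transitivity (\int[mu]_x (h (0 + (Num.sqrt 2)^-1 * x)%R * (2 * normal_peak 1)%:E))%E.
  apply: eq_integral => x _; rewrite /h -!EFinM; congr EFin.
  rewrite normal_pdfE ?oner_eq0// add0r /gauss_fun /normal_fun subr0 expr1n.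
  rewrite exprMn exprVn sqr_sqrtr//.
  rewrite (_ : - (2^-1 * x ^+ 2) = - x ^+ 2 / (1 *+ 2)); last by field.
  by field.
rewrite ge0_integralZr//.
- rewrite ge0_integral_lebesgue_affine// invrK ge0_integralZr//.
  rewrite integralT_sqr_gauss -!EFinM; congr EFin.
  rewrite /normal_peak expr1n mul1r -[pi *+ 2]mulr_natr sqrtrM ?pi_ge0//.
  by field; rewrite !gt_eqF.
- exact: (measurableT_comp mh (measurable_affine_fun 0 _)).
- by rewrite lee_fin mulr_ge0// normal_peak_ge0.
Qed.

(** Reflection has slope [-1], outside the positive slopes treated above; it rests on the invariance
    of Lebesgue measure under negation. *)
Lemma ge0_integral_lebesgue_oppr (f : R -> \bar R) :
  measurable_fun [set: R] f -> (forall x, (0 <= f x)%E) ->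
  (\int[mu]_x f (- x)%R = \int[mu]_x f x)%E.
Proof.
move=> mf f0.
have mN : measurable_fun [set: measurableTypeR R] (-%R : _ -> measurableTypeR R).
  exact: oppr_measurable.
have := ge0_integral_pushforward mN mu measurableT mf (fun x _ => f0 x).
rewrite preimage_setT => <-.
by apply: eq_measure_integral => //= A mA _; exact: lebesgue_measureN.
Qed.

Lemma ge0_integral_normal_prob01_oppr (f : R -> \bar R) :
  measurable_fun [set: R] f -> (forall x, (0 <= f x)%E) ->
  (\int[N01]_x f (- x)%R = \int[N01]_x f x)%E.
Proof.
move=> mf f0; have mfN : measurable_fun [set: R] (fun x => f (- x)).
  exact: (measurableT_comp mf (@oppr_measurable R setT)).
rewrite (ge0_integral_normal_prob 0 1 mfN (fun x => f0 _)).
rewrite (ge0_integral_normal_prob 0 1 mf f0) -[RHS]ge0_integral_lebesgue_oppr.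
- apply: eq_integral => x _; congr (_ * _%:E)%E.
  by rewrite !normal_pdfE ?oner_eq0// /normal_fun !subr0 sqrrN.
- by apply: emeasurable_funM => //; apply/measurable_EFinP; exact: measurable_normal_pdf.
- by move=> x; rewrite mule_ge0// lee_fin normal_pdf_ge0.
Qed.

End normal_moments.

(** * Mean and variance of a standard normal variable *)

Section std_normal_variable.
Context d (T : measurableType d) (R : realType) (P : probability T R).

Lemma Lfun2_sqr (X : T -> R) : measurable_fun setT X ->
  (\int[P]_x (X x ^+ 2)%:E < +oo)%E -> X \in Lfun P 2%:E.
Proof.
move=> mX X2; rewrite inE; apply/andP; split; rewrite inE//=.
rewrite /finite_norm unlock /=; apply: poweR_lty.
by under eq_integral => x _ do rewrite powR_mulrn// real_normK ?num_real//.
Qed.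

Section law.
Variable X : T -> R.
Hypothesis mX : measurable_fun setT X.
(** Normality is expressed through integrals of nonnegative functions, the form in which the
    coordinates of a normal vector provide it. *)
Hypothesis lawX : forall f : R -> \bar R, measurable_fun [set: R] f ->
  (forall x, (0 <= f x)%E) -> (\int[P]_x f (X x) = \int[normal_prob 0 1]_y f y)%E.

Lemma expectation_std_normal_sqr : ('E_P[X ^+ 2] = 1)%E.
Proof.
rewrite unlock -normal_prob01_sqr -(lawX (f := fun y => (y ^+ 2)%:E))//.
- by apply/measurable_EFinP; exact: measurable_funX.
- by move=> x; rewrite lee_fin sqr_ge0.
Qed.

Lemma Lfun2_std_normal : X \in Lfun P 2%:E.
Proof.
apply: Lfun2_sqr => //; have := expectation_std_normal_sqr.
by rewrite unlock => ->; rewrite ltry.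
Qed.

(** By symmetry of the law the positive and negative parts of [X] have the same integral, which is
    finite since [X] has a second moment. *)
Lemma expectation_std_normal : ('E_P[X] = 0)%E.
Proof.
have X1 : P.-integrable setT (EFin \o X).
  by apply/Lfun1_integrable/Lfun_subset12; [exact: fin_num_measure|exact: Lfun2_std_normal].
rewrite unlock integralE.
have mp : measurable_fun [set: R] (fun y : R => (maxe y%:E 0)%E).
  by apply: measurable_maxe => //; exact/measurable_EFinP.
have E1 : (\int[P]_x (EFin \o X)^\+ x = \int[normal_prob 0 1]_y maxe y%:E 0)%E.
  rewrite -lawX//; last by move=> x; rewrite le_max lexx orbT.
  by apply: eq_integral => x _; rewrite funeposE.
have E2 : (\int[P]_x (EFin \o X)^\- x = \int[normal_prob 0 1]_y maxe y%:E 0)%E.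
  rewrite -ge0_integral_normal_prob01_oppr//; last first.
    by move=> x; rewrite le_max lexx orbT.
  rewrite -(lawX (f := fun y => maxe (- y)%:E 0%E)).
  - by apply: eq_integral => x _; rewrite funenegE.
  - exact: (measurableT_comp mp (@oppr_measurable R setT)).
  - by move=> x; rewrite le_max lexx orbT.
rewrite E1 E2 subee// -E1.
by apply: integrable_pos_fin_num.
Qed.

Lemma variance_std_normal : ('V_P[X] = 1)%E.
Proof.
rewrite varianceE ?Lfun2_std_normal// expectation_std_normal_sqr expectation_std_normal.
by rewrite expe2 mule0 sube0.
Qed.

End law.
End std_normal_variable.

(** * Independence, covariance and almost sure equality *)

Section independence.
Context d (T : measurableType d) (R : realType) (P : probability T R).

(** The joint law of [X] and [Y] agrees with the product of their laws on rectangles, hence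
    everywhere; Fubini then factors the integral of the product. *)
Lemma independent_expectationM (X Y : {RV P >-> R}) :
  (X : T -> R) \in Lfun P 1 -> (Y : T -> R) \in Lfun P 1 ->
  (X * Y : T -> R) \in Lfun P 1 ->
  (forall A B : set R, measurable A -> measurable B ->
    P (X @^-1` A `&` Y @^-1` B) = P (X @^-1` A) * P (Y @^-1` B))%E ->
  ('E_P[X * Y] = 'E_P[X] * 'E_P[Y])%E.
Proof.
move=> X1 Y1 XY1 indep.
have mXY : measurable_fun setT (fun x => (X x, Y x)) by exact: measurable_fun_pair.
pose XY : {RV P >-> (R * R)%type} :=
  HB.pack (fun x => (X x, Y x)) (isMeasurableFun.Build _ _ _ _ _ mXY).
pose f (u : R * R) := (u.1 * u.2)%:E.
have mf : measurable_fun setT f.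
  by apply/measurable_EFinP; apply: measurable_funM.
have iX : P.-integrable setT (EFin \o X) by exact/Lfun1_integrable.
have iY : P.-integrable setT (EFin \o Y) by exact/Lfun1_integrable.
have iXY : P.-integrable setT (f \o XY) by exact/Lfun1_integrable.
pose DX := distribution P X; pose DY := distribution P Y.
have jointE A : measurable A -> (DX \x DY)%E A = distribution P XY A.
  apply: product_measure_unique => B C mB mC; exact: indep.
have mid : measurable_fun [set: R] (EFin : R -> \bar R) by exact/measurable_EFinP.
have iDX : DX.-integrable setT (EFin : R -> \bar R).
  exact: integrable_pushforward.
have iDY : DY.-integrable setT (EFin : R -> \bar R).
  exact: integrable_pushforward.
(* Fubini needs integrability for the product measure; it is transferred from the joint law. *)
have iD : (DX \x DY)%E.-integrable setT f.
  have /integrableP[_ fin] : (distribution P XY).-integrable setT f.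
    exact: integrable_pushforward.
  apply/integrableP; split => //.
  by rewrite (eq_measure_integral (distribution P XY)) => // A mA _; exact: jointE.
have EX : ('E_P[X] = (\int[DX]_x x%:E))%E by rewrite unlock integral_distribution.
have EY : ('E_P[Y] = (\int[DY]_x x%:E))%E by rewrite unlock integral_distribution.
transitivity (\int[DX \x DY]_u f u)%E.
  rewrite (eq_measure_integral (distribution P XY)); last first.
    by move=> A mA _; exact: jointE.
  by rewrite integral_distribution// unlock.
rewrite -integral12_prod_meas1//.
transitivity (\int[DX]_x (x%:E * 'E_P[Y]))%E.
  apply: eq_integral => x _; rewrite /fubini_F /f.
  under eq_integral do rewrite EFinM.
  by rewrite integralZl// EY.
rewrite EX -(fineK (expectation_fin_num Y1)) integralZr//.
Qed.

Lemma independent_covariance (X Y : {RV P >-> R}) :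
  (X : T -> R) \in Lfun P 2%:E -> (Y : T -> R) \in Lfun P 2%:E ->
  (forall A B : set R, measurable A -> measurable B ->
    P (X @^-1` A `&` Y @^-1` B) = P (X @^-1` A) * P (Y @^-1` B))%E ->
  covariance P X Y = 0%E.
Proof.
move=> X2 Y2 indep.
have PT : P setT \is a fin_num := fin_num_measure P _ measurableT.
have X1 := Lfun_subset12 PT X2; have Y1 := Lfun_subset12 PT Y2.
have XY1 := Lfun2_mul_Lfun1 X2 Y2.
rewrite covarianceE// independent_expectationM// subee//.
by rewrite fin_numM// expectation_fin_num.
Qed.

(** Needed because the closed form of the Euler step is established only almost surely. *)
Lemma variance_ae_eq (X Y : T -> R) :
  measurable_fun setT X -> measurable_fun setT Y ->
  {ae P, forall x, X x = Y x} -> ('V_P[X] = 'V_P[Y])%E.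
Proof.
move=> mX mY XY.
have EXY : ('E_P[X] = 'E_P[Y])%E.
  rewrite unlock; apply: ae_eq_integral => //; try exact/measurable_EFinP.
  by apply: filterS XY => x /= -> _.
rewrite /variance [in LHS]unlock [in RHS]unlock EXY.
rewrite unlock; apply: ae_eq_integral => //.
- by apply/measurable_EFinP; apply: measurable_funM; apply: measurable_funB.
- by apply/measurable_EFinP; apply: measurable_funM; apply: measurable_funB.
- by apply: filterS XY => x /= h _; rewrite !fctE /= h.
Qed.

End independence.

(** * The law of the flow path from a point mass *)

Section flow_law.
Context d (T : measurableType d) (R : realType) (P : probability T R) (n : nat).
Implicit Types X : {RV P >-> 'rV[R]_n}.

Lemma measurable_RV_coord X i : measurable_fun setT (fun x => X x 0 i).
Proof. exact: (measurableT_comp (@measurable_coord _ _ _ i)). Qed.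

(** A singleton is a box of singletons, hence measurable; it has mass 1, so its complement is
    null. *)
Lemma has_law_dirac_ae X a : has_law X \d_a -> {ae P, forall x, X x = a}.
Proof.
move=> lX.
have m1 : measurable [set a].
  rewrite (_ : [set a] = [set v : 'rV[R]_n | forall i, [set a 0 i] (v 0 i)]).
    by apply: (measurable_box (A := fun i => [set a 0 i])) => i; exact: measurable_set1.
  by apply/seteqP; split => [_ -> i//|v h]; apply/rowP => i; exact: h.
have mX : measurable (X @^-1` [set a]).
  by rewrite -[X in measurable X]setTI; exact: (measurable_funPT X).
exists (~` (X @^-1` [set a])); split.
- exact: measurableC.
- rewrite probability_setC//; have := lX _ m1.
  by rewrite /distribution /pushforward => ->; rewrite diracE mem_set//= subee.
- by [].
Qed.

Lemma has_law_std_normal_coord X i : has_law X (std_normal_rV R n) ->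
  forall f : R -> \bar R, measurable_fun [set: R] f -> (forall x, (0 <= f x)%E) ->
  (\int[P]_x f (X x 0%R i) = \int[normal_prob 0 1]_y f y)%E.
Proof.
move=> lX f mf f0.
have mfi : measurable_fun [set: 'rV[R]_n] (fun v => f (v 0%R i)).
  exact: (measurableT_comp mf (@measurable_coord _ _ _ i)).
rewrite -(@ge0_integral_distribution _ _ _ _ _ P X _ mfi)//.
rewrite (eq_measure_integral (std_normal_rV R n)); last by move=> A mA _; exact: lX.
apply: ge0_integral_power_measure_coord => //.
exact: probability_setT.
Qed.

(** Almost surely the path is the affine image [(1 - t) *: a + t *: eps] of a standard normal
    vector, so the Gaussian substitution applies to the indicator of [A]. *)
Lemma flow_path_density (t : R) (a : 'rV[R]_n) (z0 eps : {RV P >-> 'rV[R]_n}) :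
  0 < t -> has_law z0 \d_a -> has_law eps (std_normal_rV R n) ->
  forall A, measurable A ->
  P ((fun x => flow_path t (z0 x) (eps x)) @^-1` A) =
  (\int[lebesgue_rV R n]_(z in A) (gaussian_pdf ((1 - t) *: a) t z)%:E)%E.
Proof.
move=> t0 lz0 leps A mA.
pose zt x := flow_path t (z0 x) (eps x).
pose m := (1 - t) *: a.
have mzt : measurable_fun setT zt.
  apply/measurable_fun_rVP => i; rewrite /zt /flow_path.
  under eq_fun do rewrite !mxE.
  by apply: measurable_funD; apply: measurable_funM => //; exact: measurable_RV_coord.
pose f (z : 'rV[R]_n) : \bar R := (\1_A z)%:E.
have mf : measurable_fun setT f by apply/measurable_EFinP; exact: measurable_indic.
have f0 z : (0 <= f z)%E by rewrite lee_fin.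
transitivity (\int[P]_x f (zt x))%E.
  rewrite (_ : (fun x => f (zt x)) = fun x => (\1_(zt @^-1` A) x)%:E)//.
  rewrite integral_indic ?setIT//.
  by rewrite -[X in measurable X]setTI; exact: mzt.
transitivity (\int[P]_x f (m + t *: eps x)%R)%E.
  have mm : measurable_fun setT (fun x => m + t *: eps x).
    exact: (measurableT_comp (measurable_rV_affine m t)).
  apply: ae_eq_integral => //.
  - exact: (measurableT_comp mf mzt).
  - exact: (measurableT_comp mf mm).
  by apply: filterS (has_law_dirac_ae lz0) => x /= z0a _; rewrite /zt z0a.
have mfm := measurableT_comp mf (measurable_rV_affine m t).
rewrite -(@ge0_integral_distribution _ _ _ _ _ P eps _ mfm (fun y => f0 _)).
rewrite (eq_measure_integral (std_normal_rV R n)); last by move=> B mB _; exact: leps.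
rewrite ge0_integral_std_normal_affine// [RHS]integral_mkcond.
apply: eq_integral => z _; rewrite /f patchE indicE.
by case: (z \in A); rewrite ?mul1e ?mul0e.
Qed.

End flow_law.

(** * The Euler-Maruyama step and its noise coefficient *)

Theorem mainTheorem3 (R : realType) (n : nat)
  (dT : measure_display) (T : measurableType dT) (P : probability T R)
  (t t' s : R) (ht' : 0 <= t') (htt' : t' < t) (ht : t <= 1) (hs : 0 <= s)
  (zstar : 'rV[R]_n) (z0 eps w : {RV P >-> 'rV[R]_n})
  (hz0 : has_law z0 \d_zstar)
  (heps : has_law eps (std_normal_rV R n))
  (hw : has_law w (std_normal_rV R n))
  (hz0eps : independent_RV z0 eps)
  (hepsw : independent_RV eps w)
  (p : 'rV[R]_n -> R)
  (hp : is_continuous_density P (fun x => flow_path t (z0 x) (eps x)) p) :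
  let dt := t - t' in
  let zt := fun x => flow_path t (z0 x) (eps x) in
  let ut := fun x => eps x - zstar in
  let z_Euler := fun x => euler_maruyama p s dt (zt x) (ut x) (w x) in
  [/\ {ae P, forall x, z_Euler x =
        (1 - t') *: zstar + (t' - s ^+ 2 * dt / (2 * t)) *: eps x
        + (s * Num.sqrt dt) *: w x},
      forall i : 'I_n,
        std_dev P (fun x => (z_Euler x - (1 - t') *: zstar) 0 i) =
        (Num.sqrt ((t' - s ^+ 2 * dt / (2 * t)) ^+ 2 + s ^+ 2 * dt))%:E
    & 0 < s ->
        t' < Num.sqrt ((t' - s ^+ 2 * dt / (2 * t)) ^+ 2 + s ^+ 2 * dt)].
Proof.
move=> dt zt ut z_Euler.
have t0 : 0 < t by lra.
have dt0 : 0 < dt by rewrite /dt; lra.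
pose m := (1 - t) *: zstar.
have pE : p = gaussian_pdf m t.
  case: hp => cp p0 mp pP; apply: continuous_density_unique => //.
  - by apply: continuous_gaussian_pdf; rewrite gt_eqF.
  - exact: measurable_gaussian_pdf.
  - by move=> z; exact: gaussian_pdf_ge0.
  - by move=> A mA; rewrite -pP// (flow_path_density t0 hz0 heps).
have z_EulerE x : z_Euler x = zt x + dt *: (zstar - eps x -
    (2^-1 * s ^+ 2 / t ^+ 2) *: (zt x - m)) + (s * Num.sqrt dt) *: w x.
  rewrite /z_Euler /euler_maruyama pE score_gaussian_pdf// /ut opprB.
  by rewrite scalerA mulrN scaleNr.
have aeE : {ae P, forall x, z_Euler x =
    (1 - t') *: zstar + (t' - s ^+ 2 * dt / (2 * t)) *: eps x
    + (s * Num.sqrt dt) *: w x}.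
  (* Where [z0 x = zstar], one has [zt x - m = t *: eps x], so the score is [- t^-1 *: eps x] and
     the coefficients of [zstar] and [eps x] can be compared. *)
  apply: filterS (has_law_dirac_ae hz0) => x z0x; rewrite z_EulerE; congr (_ + _).
  apply/rowP => i; rewrite /zt /flow_path z0x /m !mxE /dt; field.
  by rewrite gt_eqF.
split=> [//|i|s0].
- pose X x := eps x 0 i; pose Y x := w x 0 i.
  have mX : measurable_fun setT X by exact: measurable_RV_coord.
  have mY : measurable_fun setT Y by exact: measurable_RV_coord.
  pose Xm : {RV P >-> R} := HB.pack X (isMeasurableFun.Build _ _ _ _ _ mX).
  pose Ym : {RV P >-> R} := HB.pack Y (isMeasurableFun.Build _ _ _ _ _ mY).
  have lX := has_law_std_normal_coord i heps; have lY := has_law_std_normal_coord i hw.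
  pose a := t' - s ^+ 2 * dt / (2 * t); pose b := s * Num.sqrt dt.
  have X2 : X \in Lfun P 2%:E by exact: Lfun2_std_normal.
  have Y2 : Y \in Lfun P 2%:E by exact: Lfun2_std_normal.
  have aX2 : a \o* X \in Lfun P 2%:E by apply: Lfun_scale => //; rewrite ler1n.
  have bY2 : b \o* Y \in Lfun P 2%:E by apply: Lfun_scale => //; rewrite ler1n.
  have PT : P setT \is a fin_num := fin_num_measure P _ measurableT.
  have XY0 : covariance P X Y = 0%E.
    apply: (independent_covariance (X := Xm) (Y := Ym)) => // A B mA mB.
    have mi C : measurable C -> measurable ((fun v : 'rV[R]_n => v 0 i) @^-1` C).
      by move=> mC; rewrite -[X in measurable X]setTI; exact: measurable_coord.
    exact: (hepsw _ _ (mi _ mA) (mi _ mB)).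
  have cov0 : covariance P (a \o* X) (b \o* Y) = 0%E.
    have X1 := Lfun_subset12 PT X2; have Y1 := Lfun_subset12 PT Y2.
    rewrite covarianceZl ?(Lfun_subset12 PT bY2) ?(Lfun2_mul_Lfun1 X2 bY2)//.
    by rewrite covarianceZr ?(Lfun2_mul_Lfun1 X2 Y2)// XY0 !mule0.
  rewrite /std_dev (@variance_ae_eq _ _ _ _ _ (a \o* X \+ b \o* Y)).
  + rewrite varianceD// !varianceZ// cov0 mule0 adde0.
    rewrite !variance_std_normal// !mule1 -EFinD /= exprMn sqr_sqrtr//.
    exact: ltW.
  (* Measurability of the actual coordinate is read off from [z_EulerE], which holds at every
     point. *)
  + pose c := 2^-1 * s ^+ 2 / t ^+ 2.
    pose Z x := (1 - t) * z0 x 0 i + t * X x.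
    rewrite (_ : (fun x => _) = fun x =>
        Z x + dt * (zstar 0 i - X x - c * (Z x - m 0 i)) + b * Y x - (1 - t') * zstar 0 i).
      have mZ : measurable_fun setT Z.
        by apply: measurable_funD; apply: measurable_funM => //; exact: measurable_RV_coord.
      apply: measurable_funB => //; apply: measurable_funD; last exact: measurable_funM.
      apply: measurable_funD => //; apply: measurable_funM => //.
      apply: measurable_funB; first exact: measurable_funB.
      by apply: measurable_funM => //; exact: measurable_funB.
    by apply/funext => x; rewrite z_EulerE /zt /flow_path !mxE.
  + by apply: measurable_funD; exact: measurable_funM.
  + apply: filterS aeE => x ->; rewrite !mxE /X /Y /a /b /=; ring.
(* With [k = s ^+ 2 * dt], the cross term [- k * t' / t] and the added [k] combine to
   [k * (t - t') / t = k * dt / t]. *)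
- have -> : (t' - s ^+ 2 * dt / (2 * t)) ^+ 2 + s ^+ 2 * dt =
      t' ^+ 2 + (((s ^+ 2 * dt) / (2 * t)) ^+ 2 + s ^+ 2 * dt * (dt / t)).
    by rewrite /dt; field; rewrite gt_eqF.
  have gain : 0 < (s ^+ 2 * dt / (2 * t)) ^+ 2 + s ^+ 2 * dt * (dt / t).
    by rewrite ltr_wpDl ?sqr_ge0// !mulr_gt0 ?invr_gt0// exprn_gt0.
  rewrite -[ltLHS](ger0_norm ht') -sqrtr_sqr ltr_sqrt ?ltrDl//.
  by rewrite ltr_wpDl ?sqr_ge0.
Qed.
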